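(* For every integer $d\ge 2$, one has $\delta^\star(d)<\tfrac12\ln(d)$. Moreover, for $d=2$ and $d=3$, one has $\delta^\star(d)=\gamma(d)$.
   Context: For $x\in\mathbb{R}^d$ let $\sigma_{\max}(x)=\max_{i=1,\dots,d}x_i$. For $f,\sigma\colon\mathbb{R}^d\to\mathbb{R}$ write $\|f-\sigma\|_\infty=\sup_{x\in\mathbb{R}^d}|f(x)-\sigma(x)|\in[0,\infty]$. A function $f\colon\mathbb{R}^d\to\mathbb{R}$ is $1$-smooth in $\|\cdot\|_\infty$ if it is differentiable and $\|\nabla f(x)-\nabla f(y)\|_1\le\|x-y\|_\infty$ for all $x,y\in\mathbb{R}^d$. Define $$\delta^\star(d)=\inf\{\|f-\sigma_{\max}\|_\infty : f\colon\mathbb{R}^d\to\mathbb{R}\text{ is convex and }1\text{-smooth in }\|\cdot\|_\infty\}.$$ For an integer $d\ge2$ define $$\gamma(d)=\max\ \sum_{\ell=1}^{k}\left(1-\frac{j_{\ell-1}}{j_\ell}\right)^2,$$ where the maximum is over all integers $k\ge 1$ and all integer sequences $1=j_0<j_1<\dots<j_{k-1}<j_k=d$. *)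

(* Defs.v *)
From HB Require Import structures.
From mathcomp Require Import all_boot all_order all_algebra.
From mathcomp Require Import all_classical all_reals all_analysis.
From mathcomp Require Import zify.

Set Implicit Arguments.
Unset Strict Implicit.
Unset Printing Implicit Defensive.

Import Order.TTheory GRing.Theory Num.Theory.
Import numFieldNormedType.Exports.

Local Open Scope classical_set_scope.
Local Open Scope ring_scope.

Definition sigma_max (R : realType) (d : nat) (x : 'rV[R]_d) : R :=
  sup [set x ord0 i | i in [set: 'I_d]].

Definition gradient (R : realType) (d : nat) (f : 'rV[R]_d -> R)
    (x : 'rV[R]_d) : 'rV[R]_d :=
  \row_i 'D_(delta_mx ord0 i) f x.

Definition norm1 (R : realType) (d : nat) (v : 'rV[R]_d) : R :=
  \sum_i `|v ord0 i|.

(* The library norm [`|_|] on ['rV[R]_d] is the sup norm (see [mx_normrE]). *)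
Definition one_smooth (R : realType) (d : nat) (f : 'rV[R]_d -> R) : Prop :=
  (forall x, differentiable f x) /\
  (forall x y, norm1 (gradient f x - gradient f y) <= `|x - y|).

Definition sup_dist (R : realType) (d : nat) (f g : 'rV[R]_d -> R) : \bar R :=
  ereal_sup [set `|f x - g x|%:E | x in [set: 'rV[R]_d]].

Definition delta_star (R : realType) (d : nat) : \bar R :=
  ereal_inf [set sup_dist f (@sigma_max R d) | f in
    [set f : 'rV[R]_d -> R |
      convex_function [set: 'rV[R]_d] f /\ one_smooth f]].

Definition admissible (d k : nat) (j : nat -> nat) : Prop :=
  [/\ (1 <= k)%N, j 0%N = 1%N, j k = d & forall l, (l < k)%N -> (j l < j l.+1)%N].

Definition gamma_sum (R : realType) (k : nat) (j : nat -> nat) : R :=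
  \sum_(1 <= l < k.+1) (1 - (j l.-1)%:R / (j l)%:R) ^+ 2.

Definition gamma_values (R : realType) (d : nat) : set R :=
  [set v | exists k j, admissible d k j /\ v = gamma_sum R k j].
Arguments gamma_values : clear implicits.

Definition gamma (R : realType) (d : nat) : R := sup (gamma_values R d).

(* The suprema in [sigma_max] and [gamma] are attained, hence maxima. *)

Lemma finite_sup_max (R : realType) (A : set R) :
  finite_set A -> A !=set0 -> A (sup A) /\ ubound A (sup A).
Proof.
move=> /finite_seqP[s ->] [a /= sa].
have [m ms mub] : exists2 m, m \in s & forall y, y \in s -> y <= m.
  elim: s a sa => // b s IH _ _; case: s IH => [_|c s /(_ c)].
    by exists b => [|y]; rewrite inE // => /eqP->.
  rewrite mem_head => /(_ isT)[m ms mub]; case: (leP m b) => mb.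
    exists b; rewrite ?mem_head// => y; rewrite inE => /predU1P[->//|/mub ym].
    exact: le_trans ym mb.
  exists m; first by rewrite inE ms orbT.
  by move=> y; rewrite inE => /predU1P[->|/mub//]; exact: ltW.
suff -> : sup [set` s] = m by [].
apply/eqP; rewrite eq_le; apply/andP; split.
  by apply: ge_sup => //; exists a.
by apply: ub_le_sup => //; exists m.
Qed.

Lemma sigma_max_is_max (R : realType) (d : nat) (x : 'rV[R]_d) : (0 < d)%N ->
  (exists i, x ord0 i = sigma_max x) /\ (forall i, x ord0 i <= sigma_max x).
Proof.
move=> d0; have [||[i _ xi] ub] :=
    @finite_sup_max R [set x ord0 i | i in [set: 'I_d]].
- exact/finite_image/finite_finset.
- by exists (x ord0 (Ordinal d0)), (Ordinal d0).
by split=> [|k]; [exists i|apply: ub; exists k].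
Qed.

Lemma admissible_homo (d k : nat) (j : nat -> nat) : admissible d k j ->
  forall l m, (l <= m <= k)%N -> (j l + (m - l) <= j m)%N.
Proof.
move=> [_ _ _ jS] l m /andP[lm]; rewrite -(subnK lm) addnK addnC.
elim: (m - l)%N => [|n IH]; first by rewrite !addn0.
by rewrite !addnS => nk; apply: leq_ltn_trans (IH (ltnW nk)) (jS _ nk).
Qed.

Lemma gamma_is_max (R : realType) (d : nat) : (2 <= d)%N ->
  gamma_values R d (gamma R d) /\ ubound (gamma_values R d) (gamma R d).
Proof.
move=> d2; apply: finite_sup_max; last first.
  exists (gamma_sum R 1 (fun l => if l is 0 then 1%N else d)), 1%N.
  by exists (fun l => if l is 0 then 1%N else d); split => //; split=> // -[|l].
pose g (p : 'I_d.+1 * {ffun 'I_d.+1 -> 'I_d.+1}) :=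
  gamma_sum R p.1 (fun l => p.2 (inord l)).
apply: (@sub_finite_set _ _ [set g p | p in setT]); last first.
  exact/finite_image/finite_finset.
move=> _ [k [j [adm ->]]]; have mono := admissible_homo adm.
have [_ j0 jk _] := adm.
have kd : (k < d.+1)%N.
  by have := mono 0%N k; rewrite leqnn subn0 jk j0 => /(_ isT); lia.
exists (Ordinal kd, [ffun i : 'I_d.+1 => inord (j i)]) => //.
rewrite /g /gamma_sum /=; apply: eq_big_nat => l /andP[l1 lk].
have jE m : (m <= k)%N ->
    [ffun i : 'I_d.+1 => inord (j i) : 'I_d.+1] (inord m) = j m :> nat.
  move=> mk; have jd : (j m < d.+1)%N.
    by have := mono m k; rewrite mk leqnn jk => /(_ isT); lia.
  have md : (m < d.+1)%N by exact: leq_ltn_trans mk kd.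
  by rewrite ffunE !inordK// inordK.
by rewrite !jE//; lia.
Qed.

(* Main.v *)
From HB Require Import structures.
Require Import Defs.
From mathcomp Require Import all_boot all_order all_algebra.
From mathcomp Require Import all_classical all_reals all_analysis.
From mathcomp Require Import ring lra zify.

(** Convex duality turns the question into one about the simplex.  A convex
    1-smooth [f] at distance at most [r] from the maximum function is the
    conjugate of a function [h] on the probability simplex that is 1-strongly
    convex for the l1 norm, and the best additive shift of [f] makes the
    distance half of the oscillation of [h].  Minimizing the distance therefore
    amounts to finding strongly convex functions of small oscillation.

    Upper bounds.  [delta_star_le] carries out the construction: given [h], the
    function [f x = max_p (<x, p> - h p) + const] has the maximizer [P x] as its
    gradient.  Strong convexity of [h] makes the maximum grow quadratically away
    from [P x] ([quadratic_growth]), which bounds the second-order error of [f]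
    and makes [P] 1-Lipschitz from the sup norm to the l1 norm.

    - For [d = 2] and [d = 3], [h = c |p|^2] with [c = 2 (1 - 1/d)] is already
      strongly convex for the l1 norm, because on zero-sum vectors the l1 norm
      is controlled by the Euclidean one with the right constant.  This yields
      the distance [(1 - 1/d)^2].
    - For general [d], the negative entropy is strongly convex by Pinsker's
      inequality and has oscillation [ln d], which only gives [ln d / 2].  To
      gain strictly, precompose it with the contraction
      [p |-> (1 - l) p + l u] towards the barycenter [u], and divide by
      [(1 - l)^2] to restore the strong convexity.  Near a vertex the entropy
      has infinite slope: the contraction lowers the oscillation by an amount
      of order [l ln (1/l)], whereas the rescaling costs only about
      [2 l ln d].  The choice [l = 1/d^3] is small enough for the gain to win
      ([delta_star_lt]).

    Lower bound.  For every admissible [f], the gradient [g] at the origin has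
    coordinates of sum 1, since [f] stays close to the maximum along the
    diagonal.  Some coordinate [i] has [g_i <= 1/d], so that [e_i - g] has l1
    norm at least [2 (1 - 1/d)].  The second-order upper bound of [f] at 0, in
    the direction that norms [e_i - g], keeps [f] below [x_i] by an amount
    quadratic in this norm, which forces [r >= (1 - 1/d)^2]
    ([dist_lower_bound]).  For [d = 2, 3] this is also the value of [gamma],
    attained by the one-step sequence [1 < d]. *)

Set Implicit Arguments.
Unset Strict Implicit.
Unset Printing Implicit Defensive.

Import Order.TTheory GRing.Theory Num.Theory.
Import numFieldNormedType.Exports.
Local Open Scope classical_set_scope.
Local Open Scope ring_scope.

(** * The pairing of vectors with covectors *)

Definition dot {R : realType} {d : nat} (u v : 'rV[R]_d) : R :=
  \sum_i u ord0 i * v ord0 i.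

Lemma dotDl {R : realType} {d : nat} (u v w : 'rV[R]_d) :
  dot (u + v) w = dot u w + dot v w.
Proof. by rewrite -big_split; apply: eq_bigr => i _; rewrite mxE mulrDl. Qed.

Lemma dotC {R : realType} {d : nat} (u v : 'rV[R]_d) : dot u v = dot v u.
Proof. by apply: eq_bigr => i _; rewrite mulrC. Qed.

Lemma dotDr {R : realType} {d : nat} (u v w : 'rV[R]_d) :
  dot u (v + w) = dot u v + dot u w.
Proof. by rewrite dotC dotDl !(dotC u). Qed.

Lemma dotZl {R : realType} {d : nat} (a : R) (u v : 'rV[R]_d) :
  dot (a *: u) v = a * dot u v.
Proof. by rewrite mulr_sumr; apply: eq_bigr => i _; rewrite mxE mulrA. Qed.

Lemma dotZr {R : realType} {d : nat} (a : R) (u v : 'rV[R]_d) :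
  dot u (a *: v) = a * dot u v.
Proof. by rewrite dotC dotZl dotC. Qed.

Lemma dotBl {R : realType} {d : nat} (u v w : 'rV[R]_d) :
  dot (u - v) w = dot u w - dot v w.
Proof. by rewrite dotDl -scaleN1r dotZl mulN1r. Qed.

Lemma dotBr {R : realType} {d : nat} (u v w : 'rV[R]_d) :
  dot u (v - w) = dot u v - dot u w.
Proof. by rewrite dotC dotBl !(dotC u). Qed.

Lemma dot_delta {R : realType} {d : nat} (u : 'rV[R]_d) (i : 'I_d) :
  dot u (delta_mx ord0 i) = u ord0 i.
Proof.
rewrite /dot (bigD1 i) //= mxE !eqxx mulr1 big1 ?addr0 // => k ki.
by rewrite mxE (negbTE ki) andbF mulr0.
Qed.

Lemma coord_le_norm {R : realType} {d : nat} (v : 'rV[R]_d) (i : 'I_d) :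
  `|v ord0 i| <= `|v|.
Proof.
by rewrite [leRHS]mx_normrE; apply/bigmax_geP; right; exists (ord0, i).
Qed.

Lemma dot_le_norm {R : realType} {d : nat} (u v : 'rV[R]_d) :
  dot u v <= norm1 u * `|v|.
Proof.
rewrite /norm1 mulr_suml; apply: ler_sum => i _.
by rewrite (le_trans (ler_norm _))// normrM ler_wpM2l// coord_le_norm.
Qed.

Lemma norm1_ge0 {R : realType} {d : nat} (v : 'rV[R]_d) : 0 <= norm1 v.
Proof. exact: sumr_ge0. Qed.

Lemma norm1Z {R : realType} {d : nat} (a : R) (v : 'rV[R]_d) :
  norm1 (a *: v) = `|a| * norm1 v.
Proof. by rewrite /norm1 mulr_sumr; apply: eq_bigr => i _; rewrite mxE normrM. Qed.

Lemma norm1_distC {R : realType} {d : nat} (u v : 'rV[R]_d) :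
  norm1 (u - v) = norm1 (v - u).
Proof. by rewrite -opprB -scaleN1r norm1Z normrN1 mul1r. Qed.

(** * First-order estimates for smooth convex functions *)

Lemma derive_dot {R : realType} {d : nat} (f : 'rV[R]_d -> R) (x v : 'rV[R]_d) :
  differentiable f x -> 'D_v f x = dot (gradient f x) v.
Proof.
move=> df; rewrite deriveE // {1}(row_sum_delta v) linear_sum.
by apply: eq_bigr => i _; rewrite linearZ /= -deriveE // mxE mulrC.
Qed.

Lemma is_derive_line {R : realType} {d : nat} (f : 'rV[R]_d -> R)
    (a v : 'rV[R]_d) (t : R) : differentiable f (a + t *: v) ->
  is_derive t (1 : R) (fun s : R => f (a + s *: v))
    (dot (gradient f (a + t *: v)) v).
Proof.
move=> df; rewrite -derive_dot //.
have E : (fun h : R => h^-1 *: (((fun s : R => f (a + s *: v)) \o shift t) (h *: 1)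
                               - f (a + t *: v))) =
    (fun h : R => h^-1 *: ((f \o shift (a + t *: v)) (h *: v) - f (a + t *: v))).
  by apply/funext => h /=; congr (_ *: (f _ - _)); rewrite [h *: 1]mulr1 scalerDl addrCA.
by split; [rewrite /derivable E; exact: diff_derivable | rewrite /derive E].
Qed.

(** The mean value theorem on the segment, applied after subtracting the linear
    part and the quadratic that the Lipschitz bound on the gradient predicts;
    the sign [e] treats both sides of the absolute value at once. *)
Lemma taylor1 {R : realType} {d : nat} (f : 'rV[R]_d -> R) (a v : 'rV[R]_d) :
  one_smooth f ->
  `|f (a + v) - (f a + dot (gradient f a) v)| <= `|v| ^+ 2 / 2.
Proof.
move=> [df lip].
suff H (e : R) : `|e| = 1 -> e * (f (a + v) - (f a + dot (gradient f a) v)) <=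
    `|v| ^+ 2 / 2.
  rewrite ler_norml; have := H 1; have := H (-1).
  by rewrite normrN normr1 => /(_ erefl) + /(_ erefl); lra.
move=> e1; pose k : R := `|v| ^+ 2 / 2.
pose phi (t : R) := e * (f (a + t *: v) - t * dot (gradient f a) v) - t ^+ 2 * k.
have dphi t : is_derive t (1 : R) phi
    (e * (dot (gradient f (a + t *: v)) v - dot (gradient f a) v)
     - t * `|v| ^+ 2).
  have h1 := is_derive_line (df (a + t *: v)).
  have scaleE (b c : R) : b *: (c : R^o) = b * c by [].
  by apply: is_derive_eq; rewrite !scaleE /k; field.
have [|c /itvP c01] := @MVT R phi _ 0 1 ltr01 (fun x _ => dphi x).
  by apply: derivable_within_continuous => x _; apply: ex_derive.
rewrite subr0 mulr1 /phi !scale1r !scale0r addr0 expr0n expr1n /=.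
have : e * dot (gradient f (a + c *: v) - gradient f a) v <= c * `|v| ^+ 2.
  rewrite -dotZl (le_trans (dot_le_norm _ _))// expr2 mulrA ler_wpM2r//.
  rewrite norm1Z e1 mul1r.
  by rewrite (le_trans (lip _ _))// addrAC subrr add0r normrZ ger0_norm// c01.
rewrite dotBl /k; lra.
Qed.

(** Replaces the passage to the limit in first-order arguments along a
    segment: dividing by the step [s] leaves an error of order [s]. *)
Lemma le_of_small {R : realType} (a b C : R) :
  (forall s, 0 < s < 1 -> a <= b + s * C) -> a <= b.
Proof.
move=> H; apply/ler_addgt0Pr => e e0.
pose s := Num.min (1 / 2) (e / (1 + `|C|)).
have C0 : 0 < 1 + `|C| by rewrite ltr_pwDl.
have s0 : 0 < s.
  rewrite lt_min; apply/andP; split; [lra | exact: divr_gt0].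
have s1 : s < 1 by rewrite gt_min; apply/orP; left; lra.
have := H s; rewrite s0 s1 => /(_ isT) /le_trans; apply.
rewrite lerD2l (le_trans (ler_norm _))// normrM (gtr0_norm s0).
have : s * (1 + `|C|) <= e.
  by rewrite -ler_pdivlMr// ge_min lexx orbT.
nra.
Qed.

Lemma convex_functionP {R : realType} {d : nat} (f : 'rV[R]_d -> R) :
  convex_function [set: 'rV[R]_d] f <->
  forall (s : R) x y, 0 <= s <= 1 ->
    f (s *: x + (1 - s) *: y) <= s * f x + (1 - s) * f y.
Proof.
split=> [cf s x y s01|H t x y _ _]; last first.
  by apply: (H t%:num); rewrite ge0 le1.
by have := cf (Itv01 (andP s01).1 (andP s01).2) x y; rewrite !inE => /(_ I I).
Qed.

Lemma tangent_le {R : realType} {d : nat} (f : 'rV[R]_d -> R) (a v : 'rV[R]_d) :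
  convex_function [set: 'rV[R]_d] f -> one_smooth f ->
  f a + dot (gradient f a) v <= f (a + v).
Proof.
move=> /convex_functionP cf sf.
apply: (@le_of_small _ _ _ (`|v| ^+ 2 / 2)) => s /andP[s0 s1].
have := cf s (a + v) a; rewrite (ltW s0) (ltW s1) => /(_ isT).
have -> : s *: (a + v) + (1 - s) *: a = a + s *: v.
  by rewrite scalerDr scalerBl scale1r addrC addrA subrK.
have := taylor1 a (s *: v) sf; rewrite ler_norml dotZr normrZ (gtr0_norm s0).
rewrite exprMn; set D := dot _ _; set N := `|v| ^+ 2 => /andP[+ _] => h1 h2.
have : s * (f a + D) <= s * (f (a + v) + s * (N / 2)) by nra.
by rewrite ler_pM2l.
Qed.

(** * The lower bound *)

Lemma sigma_maxP {R : realType} {d : nat} (x : 'rV[R]_d) (m : R) (i : 'I_d) :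
  x ord0 i = m -> (forall k, x ord0 k <= m) -> sigma_max x = m.
Proof.
move=> xi xm; have d0 : (0 < d)%N := leq_ltn_trans (leq0n i) (ltn_ord i).
have [[k kx] ub] := sigma_max_is_max x d0.
by apply/eqP; rewrite eq_le -{1}kx xm -xi ub.
Qed.

(** Along the diagonal the maximum function is [t |-> t], and [f] lies above its
    tangent, so the tangent is bounded by [t + r] for all [t]; an affine function
    that stays below another one has the same slope. *)
Lemma sum_gradient {R : realType} {d : nat} (f : 'rV[R]_d -> R) (r : R) :
  (0 < d)%N -> convex_function [set: 'rV[R]_d] f -> one_smooth f ->
  (forall x, `|f x - sigma_max x| <= r) -> \sum_i gradient f 0 ord0 i = 1.
Proof.
move=> d0 cf sf fr; set G := \sum_i _.
have H t : f 0 + t * G <= t + r.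
  have := tangent_le 0 (const_mx t) cf sf; rewrite add0r.
  have -> : dot (gradient f 0) (const_mx t) = t * G.
    by rewrite mulrC mulr_suml; apply: eq_bigr => i _; rewrite !mxE.
  move=> /le_trans; apply; have := fr (const_mx t).
  rewrite (@sigma_maxP _ _ _ t (Ordinal d0)) ?mxE // => [|k]; last by rewrite mxE.
  by rewrite ler_norml; lra.
have G1 (t : R) : t * (G - 1) <= r - f 0 by have := H t; lra.
apply/eqP; rewrite -subr_eq0; apply/negPn/negP => G0.
(* Any [t] with [t (G - 1) > r - f 0] contradicts the bound. *)
have := G1 ((r - f 0 + 1) / (G - 1)); rewrite divfK //; lra.
Qed.

(** The test point [x = N sgn w] with [w = e_i - g] and [N = norm1 w] maximizes
    [<w, x> - |x|^2 / 2], with value [N^2 / 2].  Comparing [f] with the maximum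
    at 0 and at [x] costs [r] twice, hence [N^2 / 2 <= 2 r]. *)
Lemma dist_lower_bound {R : realType} {d : nat} (f : 'rV[R]_d -> R) (r : R) :
  (1 < d)%N -> convex_function [set: 'rV[R]_d] f -> one_smooth f ->
  (forall x, `|f x - sigma_max x| <= r) -> (1 - d%:R^-1) ^+ 2 <= r.
Proof.
move=> d1 cf sf fr; have d0 : (0 < d)%N by lia.
have G1 := sum_gradient d0 cf sf fr; set g := gradient f 0 in G1.
have dR : (0 : R) < d%:R by rewrite ltr0n.
have [i gi] : exists i, g ord0 i <= d%:R^-1.
  apply: contrapT => /forallNP H; have : \sum_(i < d) d%:R^-1 < \sum_i g ord0 i.
    apply: ltr_sum => [|i _]; last by rewrite ltNge; apply/negP/H.
    by apply/hasP; exists (Ordinal d0); rewrite ?mem_index_enum.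
  by rewrite G1 sumr_const card_ord -[_ *+ _]mulr_natr mulVf ?ltxx// gt_eqF.
pose w : 'rV[R]_d := delta_mx ord0 i - g; pose N := norm1 w.
have N2 : 2 * (1 - d%:R^-1) <= N.
  (* Keep the sign of the i-th term and reverse the others: the lower bound for
     the l1 norm is [2 w_i] minus the vanishing sum of [w]. *)
  have : N >= \sum_k (2 * (k == i)%:R * w ord0 i - w ord0 k).
    apply: ler_sum => k _; case: eqVneq => [->|ki] /=.
      by rewrite (le_trans _ (ler_norm _))//; lra.
    by rewrite mulr0 mul0r sub0r -normrN ler_norm.
  rewrite sumrB -mulr_suml -mulr_sumr (bigD1 i) //= eqxx big1; last first.
    by move=> k /negbTE ->.
  have -> : \sum_k w ord0 k = 0.
    rewrite (_ : \sum_k _ = \sum_k ((k == i)%:R - g ord0 k)); last first.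
      by apply: eq_bigr => k _; rewrite !mxE eqxx.
    by rewrite sumrB G1 (bigD1 i) //= eqxx big1 ?addr0 ?subrr // => k /negbTE ->.
  by move: gi; rewrite !mxE !eqxx /=; lra.
pose x : 'rV[R]_d := N *: map_mx Num.sg w.
have N0 : 0 <= N by exact: norm1_ge0.
have wx : dot w x = N ^+ 2.
  rewrite dotZr expr2; congr (_ * _); apply: eq_bigr => k _.
  by rewrite [map_mx _ _ _ _]mxE [RHS]normrEsg mulrC.
have xN : `|x| <= N.
  rewrite [leLHS]mx_normrE; apply/bigmax_leP; split=> // -[k1 k] _ /=.
  rewrite mxE [map_mx _ _ _ _]mxE normrM (ger0_norm N0) ler_piMr // normr_sg.
  by case: (_ == 0).
have := taylor1 0 x sf; rewrite add0r -/g ler_norml => /andP[_ hx].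
have := fr x; have := fr 0; rewrite !ler_norml.
rewrite (@sigma_maxP _ _ 0 0 (Ordinal d0)) ?mxE // => [|k]; last by rewrite mxE.
move=> /andP[_ f0] /andP[fx _].
have := (sigma_max_is_max x d0).2 i => xi.
have : dot w x = x ord0 i - dot g x by rewrite dotBl dotC dot_delta.
rewrite wx => E; have x2 : `|x| ^+ 2 <= N ^+ 2 by rewrite ler_pXn2r// nnegrE.
have dV : (d%:R^-1 : R) <= 1 by rewrite invf_le1// ler1n.
have : (2 * (1 - d%:R^-1)) ^+ 2 <= N ^+ 2 by rewrite ler_pXn2r// nnegrE; lra.
rewrite exprMn; lra.
Qed.

Lemma delta_star_ge {R : realType} (d : nat) : (1 < d)%N ->
  (((1 - d%:R^-1) ^+ 2)%:E <= delta_star R d)%E.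
Proof.
move=> d1; apply: le_ereal_inf_tmp => _ [f [cf sf] <-].
have ub x : (`|f x - sigma_max x|%:E <= sup_dist f (@sigma_max R d))%E.
  by apply: ereal_sup_ubound; exists x.
case: (sup_dist _ _) ub => [r ub|_|/(_ 0)]; rewrite ?leey //.
by rewrite lee_fin; apply: (dist_lower_bound d1 cf sf) => x; rewrite -lee_fin.
Qed.

(** * Strongly convex functions on the simplex *)

Definition simplex (R : realType) (d : nat) : set 'rV[R]_d :=
  [set p | (forall i, 0 <= p ord0 i) /\ \sum_i p ord0 i = 1].

Definition strongly_convex (R : realType) (d : nat) (h : 'rV[R]_d -> R) :=
  forall (t : R) p q, simplex p -> simplex q -> 0 <= t <= 1 ->
  h (t *: p + (1 - t) *: q) <=
    t * h p + (1 - t) * h q - t * (1 - t) / 2 * norm1 (p - q) ^+ 2.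

Lemma simplex_delta {R : realType} {d : nat} (i : 'I_d) :
  simplex (delta_mx ord0 i : 'rV[R]_d).
Proof.
split=> [k|]; first by rewrite mxE; exact: ler0n.
rewrite (bigD1 i) //= mxE !eqxx big1 ?addr0 // => k ki.
by rewrite mxE (negbTE ki) andbF.
Qed.

Lemma simplex_convex {R : realType} {d : nat} (t : R) (p q : 'rV[R]_d) :
  0 <= t <= 1 -> simplex p -> simplex q -> simplex (t *: p + (1 - t) *: q).
Proof.
move=> /andP[t0 t1] [p0 p1] [q0 q1]; split=> [i|].
  by rewrite !mxE addr_ge0// mulr_ge0// subr_ge0.
transitivity (t * (\sum_i p ord0 i) + (1 - t) * (\sum_i q ord0 i)).
  by rewrite !mulr_sumr -big_split; apply: eq_bigr => i _; rewrite !mxE.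
by rewrite p1 q1; ring.
Qed.

Lemma differentiable_dot {R : realType} {d : nat} (g x : 'rV[R]_d) :
  differentiable (dot g) x.
Proof.
have -> : dot g = \sum_i (fun v : 'rV[R]_d => g ord0 i *: (v ord0 i : R^o)).
  by apply/funext => v; rewrite fct_sumE.
apply: differentiable_sum => i; apply: differentiableZ.
exact: differentiable_coord.
Qed.

Lemma continuous_dot {R : realType} {d : nat} (g : 'rV[R]_d) :
  continuous (dot g).
Proof. by move=> x; apply/differentiable_continuous/differentiable_dot. Qed.

Lemma compact_simplex {R : realType} {d : nat} : compact (@simplex R d).
Proof.
have -> : @simplex R d = [set v : 'rV[R]_d | forall i, `[0, 1]%classic (v ord0 i)]
    `&` (dot (const_mx 1) @^-1` [set 1]).
  apply/seteqP; split=> v /=.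
    move=> [v0 v1]; have E : dot (const_mx 1) v = 1.
      by rewrite -[RHS]v1; apply: eq_bigr => i _; rewrite mxE mul1r.
    split=> // i; rewrite in_itv /= v0 /= -[leRHS]v1 (bigD1 i) //= lerDl.
    by apply: sumr_ge0.
  move=> [v0 v1]; split=> [i|]; first by have := v0 i; rewrite in_itv /= => /andP[].
  by rewrite -[RHS]v1; apply: eq_bigr => i _; rewrite mxE mul1r.
apply: compact_closedI.
  exact: (@rV_compact R d (fun=> `[0, 1]%classic) (fun=> @segment_compact R 0 1)).
by apply: preimage_closed => [v _|]; [exact: continuous_dot|exact: closed_eq].
Qed.

Lemma exists_maximizer {R : realType} {d : nat} (h : 'rV[R]_d -> R)
    (x : 'rV[R]_d) : (0 < d)%N -> {within @simplex R d, continuous h} ->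
  exists p, simplex p /\
    forall q, simplex q -> dot x q - h q <= dot x p - h p.
Proof.
move=> d0 ch; have [|p|p ps pm] :=
    @EVT_max_rV R d (fun q => dot x q - h q) (@simplex R d) _ compact_simplex.
- by exists (delta_mx ord0 (Ordinal d0)); exact: simplex_delta.
- apply: continuousB; last exact: ch.
  exact/continuous_subspaceT/continuous_dot.
exists p; split; first by rewrite inE in ps.
by move=> q sq; apply: pm; rewrite inE.
Qed.

(** Moving from the maximizer [p] towards [q] by a step [s] cannot increase the
    objective, but strong convexity adds a gain of [s |p - q|^2 / 2] to the
    interpolated values, up to second order in [s]. *)
Lemma quadratic_growth {R : realType} {d : nat} (h : 'rV[R]_d -> R)
    (x p q : 'rV[R]_d) : strongly_convex h -> simplex p -> simplex q ->
  (forall m, simplex m -> dot x m - h m <= dot x p - h p) ->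
  dot x q - h q + norm1 (p - q) ^+ 2 / 2 <= dot x p - h p.
Proof.
move=> hsc sp sq pmax.
apply: (@le_of_small _ _ _ (norm1 (p - q) ^+ 2 / 2)) => s /andP[s0 s1].
have t01 : 0 <= 1 - s <= 1 by apply/andP; split; lra.
have := hsc (1 - s) p q sp sq t01.
have := pmax _ (simplex_convex t01 sp sq).
rewrite dotDr !dotZr subKr => h1 h2.
have : s * (dot x q - h q + norm1 (p - q) ^+ 2 / 2) <=
    s * (dot x p - h p + s * (norm1 (p - q) ^+ 2 / 2)) by nra.
by rewrite ler_pM2l.
Qed.

(** * From strongly convex functions to smooth approximations *)

Lemma gradient_of_quadratic_error {R : realType} {d : nat} (f : 'rV[R]_d -> R)
    (x g : 'rV[R]_d) :
  (forall v, `|f (x + v) - (f x + dot g v)| <= `|v| ^+ 2 / 2) ->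
  differentiable f x /\ gradient f x = g.
Proof.
move=> H.
(* The differential, packaged as a linear map for the uniqueness of
   differentials. *)
pose Lm := GRing.isLinear.Build _ _ _ _ (dot g : 'rV[R]_d -> R^o)
  (fun a u v => etrans (dotDr g (a *: u) v) (congr1 (+%R^~ _) (dotZr a g u))).
pose L : {linear 'rV[R]_d -> R^o} := HB.pack (dot g : 'rV[R]_d -> R^o) Lm.
have cL : continuous L by exact: continuous_dot.
have E : f \o shift x = cst (f x) + L +o_ (0 : 'rV[R]_d) id.
  apply/eqaddoP => e e0.
  have := @nbhs0_lt R 'rV[R]_d e e0; apply: filterS => v ve.
  rewrite [leLHS](_ : _ = `|f (x + v) - (f x + dot g v)|); last first.
    by rewrite [x + v]addrC.
  apply: le_trans (H v) _; rewrite expr2 mulrAC ler_wpM2r//.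
  by have := normr_ge0 v; lra.
have dE := diff_unique cL E.
have df : differentiable f x by apply/diff_locallyP; rewrite dE.
split=> //; apply/rowP => i.
by rewrite mxE deriveE // dE; exact: dot_delta.
Qed.

Lemma continuous_at_sum {R : realType} {T : topologicalType} (n : nat)
    (F : 'I_n -> T -> R) (x : T) :
  (forall i, {for x, continuous (F i)}) ->
  {for x, continuous (fun t => \sum_i F i t)}.
Proof.
move=> cF; have -> : (fun t => \sum_i F i t) = \sum_i F i.
  by apply/funext => t; rewrite fct_sumE.
elim/big_ind : _ => // [|f g cf cg]; first exact: cst_continuous.
exact: continuousD.
Qed.

(** With [P x] the maximizer defining [f x], optimality at the other point
    gives the supporting hyperplane [flo], hence convexity; quadratic growth
    gives the matching upper bound [fhi], hence differentiability with gradient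
    [P x].  Adding the growth inequalities at two points yields
    [|P x - P y|_1^2 <= <P x - P y, x - y>], and Hoelder's inequality concludes.
    The error is controlled above by [lo], since [<x, p> <= max x], and below by
    [hi], by testing the vertex of a largest coordinate. *)
Lemma delta_star_le {R : realType} {d : nat} (h : 'rV[R]_d -> R) (lo hi : R) :
  (0 < d)%N -> {within @simplex R d, continuous h} -> strongly_convex h ->
  (forall q, simplex q -> lo <= h q) ->
  (forall i, h (delta_mx ord0 i) <= hi) ->
  (delta_star R d <= ((hi - lo) / 2)%:E)%E.
Proof.
move=> d0 ch hsc hlo hhi.
have [P HP] := choice (fun x => exists_maximizer x d0 ch).
have sP x : simplex (P x) by case: (HP x).
have mP x : forall q, simplex q -> dot x q - h q <= dot x (P x) - h (P x).
  by case: (HP x).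
have QG x q : simplex q ->
    dot x q - h q + norm1 (P x - q) ^+ 2 / 2 <= dot x (P x) - h (P x).
  by move=> sq; exact: quadratic_growth hsc (sP x) sq (@mP x).
pose f x := dot x (P x) - h (P x) + (hi + lo) / 2.
have flo x y : f x + dot (P x) (y - x) <= f y.
  by rewrite /f dotBr !(dotC (P x)); have := mP y _ (sP x); lra.
have fhi x y : f y <= f x + dot (P x) (y - x) + `|y - x| ^+ 2 / 2.
  have q1 := QG x _ (sP y).
  have := dot_le_norm (P y - P x) (y - x).
  rewrite norm1_distC.
  rewrite /f !dotBl !dotBr !(dotC _ x) !(dotC _ y).
  (* Young's inequality absorbs the product of the two norms. *)
  have := sqr_ge0 (norm1 (P x - P y) - `|y - x|); rewrite sqrrB.
  move: q1; set N := norm1 _; set M := `|_|; set N2 := N ^+ 2; set M2 := M ^+ 2.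
  lra.
have gradf x : differentiable f x /\ gradient f x = P x.
  apply: gradient_of_quadratic_error => v.
  have := fhi x (x + v); have := flo x (x + v).
  have -> : x + v - x = v by rewrite addrC addKr.
  by rewrite ler_norml; have := sqr_ge0 `|v|; set M := `|v| ^+ 2; lra.
have cf : convex_function [set: 'rV[R]_d] f.
  apply/convex_functionP => s x y /andP[s0 s1].
  set z := _ + _; have hx := flo z x; have hy := flo z y.
  have E : s * dot (P z) (x - z) + (1 - s) * dot (P z) (y - z) = 0.
    rewrite -!dotZr -dotDr !scalerBr addrACA -opprD -scalerDl -/z.
    by rewrite [s + _]addrC subrK scale1r subrr -(scale0r z) dotZr mul0r.
  nra.
have sf : one_smooth f.
  split=> [x|x y]; first by case: (gradf x).
  rewrite (gradf x).2 (gradf y).2.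
  have qx := QG x _ (sP y); have qy := QG y _ (sP x).
  have := dot_le_norm (P x - P y) (x - y).
  rewrite norm1_distC in qy; rewrite !dotBl !dotBr !(dotC _ x) !(dotC _ y) => hN.
  have : norm1 (P x - P y) * norm1 (P x - P y) <= norm1 (P x - P y) * `|x - y|.
    by rewrite -expr2; lra.
  have := norm1_ge0 (P x - P y); rewrite le_eqVlt => /orP[/eqP <- //|N0].
  by rewrite ler_pM2l.
apply: ge_ereal_inf; exists (sup_dist f (@sigma_max R d)).
  by exists f.
apply: ge_ereal_sup => _ [x _ <-]; rewrite lee_fin.
have [[i xi] ub] := sigma_max_is_max x d0.
have up : dot x (P x) <= sigma_max x.
  have [p0 p1] := sP x; rewrite -[leRHS]mulr1 -p1 mulr_sumr.
  by apply: ler_sum => k _; rewrite ler_wpM2r.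
have := mP x _ (simplex_delta i); rewrite dot_delta xi.
have := hlo _ (sP x); have := hhi i; rewrite /f ler_norml; lra.
Qed.

(** * Dimensions two and three *)

Lemma sqr_dot_ge {R : realType} {d : nat} (p : 'rV[R]_d) : (0 < d)%N ->
  simplex p -> d%:R^-1 <= dot p p.
Proof.
move=> d0 [_ p1]; have dR : (d%:R : R) != 0 by rewrite pnatr_eq0 -lt0n.
have : 0 <= \sum_i (p ord0 i - d%:R^-1) ^+ 2 by apply: sumr_ge0 => i _; exact: sqr_ge0.
have -> : \sum_i (p ord0 i - d%:R^-1) ^+ 2 =
    dot p p - 2 * d%:R^-1 * \sum_i p ord0 i + \sum_(i < d) d%:R^-1 ^+ 2.
  rewrite /dot mulr_sumr -sumrB -big_split; apply: eq_bigr => i _ /=; ring.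
rewrite p1 sumr_const card_ord -[_ ^+ 2 *+ d]mulr_natr.
have -> : d%:R^-1 ^+ 2 * d%:R = d%:R^-1 :> R by rewrite expr2 -mulrA mulVf ?mulr1.
lra.
Qed.

(** The constant [c = 2 (1 - 1/d)] is forced by the lower bound: the oscillation
    of [c |p|^2] over the simplex is [c (1 - 1/d)], twice [(1 - 1/d)^2].  The
    hypothesis on zero-sum vectors is strong convexity of this quadratic. *)
Lemma delta_star_le_quadratic {R : realType} {d : nat} : (0 < d)%N ->
  (forall v : 'rV[R]_d, \sum_i v ord0 i = 0 ->
     norm1 v ^+ 2 <= 4 * (1 - d%:R^-1) * dot v v) ->
  (delta_star R d <= ((1 - d%:R^-1) ^+ 2)%:E)%E.
Proof.
move=> d0 H; pose c : R := 2 * (1 - d%:R^-1).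
have c0 : 0 <= c.
  by rewrite mulr_ge0// subr_ge0 invf_le1 ?ler1n ?ltr0n.
have -> : (1 - d%:R^-1 : R) ^+ 2 = (c - c * d%:R^-1) / 2.
  by rewrite /c; set k := d%:R^-1; field.
apply: (@delta_star_le _ _ (fun p => c * dot p p)) => //.
- apply: continuous_subspaceT => p.
  apply: (@continuousM _ _ (cst c) (fun p : 'rV[R]_d => dot p p)).
    exact: cst_continuous.
  apply: continuous_at_sum => i.
  by apply: (@continuousM _ _ (fun p : 'rV[R]_d => p ord0 i)
    (fun p : 'rV[R]_d => p ord0 i)); exact: coord_continuous.
- move=> t p q [_ p1] [_ q1] /andP[t0 t1].
  have /H : \sum_i (p - q) ord0 i = 0.
    rewrite (_ : \sum_i _ = \sum_i (p ord0 i - q ord0 i)); last first.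
      by apply: eq_bigr => i _; rewrite !mxE.
    by rewrite sumrB p1 q1 subrr.
  rewrite !dotBl !dotBr !dotDl !dotDr !dotZl !dotZr !(dotC q p).
  set N := norm1 _ ^+ 2; rewrite -/c.
  set A := dot p p; set B := dot p q; set C := dot q q => hN.
  have : 0 <= t * (1 - t) by rewrite mulr_ge0// subr_ge0.
  rewrite /c; nra.
- by move=> q sq; rewrite ler_wpM2l // sqr_dot_ge.
- by move=> i; rewrite dot_delta mxE !eqxx mulr1.
Qed.

Lemma delta_star2 {R : realType} : delta_star R 2 = (1 / 4)%:E.
Proof.
have E : (1 - 2%:R^-1) ^+ 2 = 1 / 4 :> R by field.
rewrite -E; apply/eqP; rewrite eq_le delta_star_ge // andbT.
apply: delta_star_le_quadratic => // v.
rewrite /norm1 /dot !big_ord_recl !big_ord0.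
set a := v _ _; set b := v _ _; rewrite !addr0 => ab.
have -> : b = - a by lra.
by rewrite normrN -mulr2n -[_ *+ 2]mulr_natr exprMn real_normK ?num_real //; lra.
Qed.

Lemma delta_star3 {R : realType} : delta_star R 3 = (4 / 9)%:E.
Proof.
have E : (1 - 3%:R^-1) ^+ 2 = 4 / 9 :> R by field.
rewrite -E; apply/eqP; rewrite eq_le delta_star_ge // andbT.
apply: delta_star_le_quadratic => // v.
rewrite /norm1 /dot !big_ord_recl !big_ord0.
set a := v _ _; set b := v _ _; set c := v _ _; rewrite !addr0 => abc.
have -> : c = - (a + b) by lra.
have -> : 4 * (1 - 3%:R^-1) = 8 / 3 :> R by field.
(* According to the signs, the l1 norm is twice the largest of |a|, |b|,
   |a + b|, and the inequality reduces to one of these three squares. *)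
have h1 := sqr_ge0 (a - b); have h2 := sqr_ge0 (2 * a + b).
have h3 := sqr_ge0 (a + 2 * b).
by rewrite normrN; case: (ger0P a) => ?; case: (ger0P b) => ?;
  case: (ger0P (a + b)) => ?; try lra; nra.
Qed.

(** * Pinsker's inequality *)

(** The right-hand side is [(x - 1)(5x + 1) / (2x (x + 2))] in partial
    fractions.  It agrees with [ln] to third order at 1: the difference has
    derivative [(x - 1)^3 / (x^2 (x + 2)^2)], hence its minimum at 1. *)
Lemma ln_ge_rational {R : realType} (x : R) : 0 < x ->
  5 / 2 - 1 / 4 * x^-1 - 27 / 4 * (x + 2)^-1 <= ln x.
Proof.
move=> x0.
pose k (y : R) := ln y - (5 / 2 - 1 / 4 * y^-1 - 27 / 4 * (y + 2)^-1).
pose dk (y : R) := (y - 1) ^+ 3 / (y ^+ 2 * (y + 2) ^+ 2).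
have k1 : k 1 = 0 by rewrite /k ln1; field.
have scaleE (b c : R) : b *: (c : R^o) = b * c by [].
have hk (y : R) : 0 < y -> is_derive y (1 : R) k (dk y).
  move=> y0; have y2 : y + 2 != 0 by apply: lt0r_neq0; lra.
  have y0' : y != 0 by exact: lt0r_neq0.
  have dln := is_derive1_ln y0.
  have d1 : is_derive y (1 : R) (fun z : R => z^-1) (- y ^- 2 *: 1).
    by apply: (@is_deriveV R (fun z : R => z)).
  have d2 : is_derive y (1 : R) (fun z : R => (z + 2)^-1) (- (y + 2) ^- 2 *: (1 + 0)).
    by apply: (@is_deriveV R (fun z : R => z + 2)).
  apply: is_derive_eq; rewrite !scaleE /dk; field.
  by rewrite y0' y2.
have ck a b : 0 < a -> {within `[a, b], continuous k}.
  move=> a0; apply: derivable_within_continuous => y; rewrite in_itv /= => /andP[ay _].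
  by have := hk y (lt_le_trans a0 ay) => ?; apply: ex_derive.
have dkE y : 0 < y -> dk y * (y - 1) >= 0.
  move=> y0; rewrite /dk mulrAC -exprSr; apply: divr_ge0; first exact: exprn_even_ge0.
  by apply: mulr_ge0; exact: sqr_ge0.
suff : 0 <= k x by rewrite /k subr_ge0.
have [x1|x1|->] := ltgtP x 1; last by rewrite k1.
- have [|c /itvP cx] := @MVT R k dk x 1 x1 _ (ck _ _ x0).
    by move=> y /itvP yx; apply: hk; rewrite (lt_trans x0) // yx.
  have c0 : 0 < c by rewrite (lt_trans x0)// cx.
  rewrite k1; have := dkE _ c0; have : c < 1 by rewrite cx.
  nra.
- have [|c /itvP cx] := @MVT R k dk 1 x x1 _ (ck _ _ ltr01).
    by move=> y /itvP yx; apply: hk; rewrite (lt_trans ltr01) // yx.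
  have c0 : 0 < c by rewrite (lt_trans ltr01)// cx.
  rewrite k1; have := dkE _ c0; have : 1 < c by rewrite cx.
  nra.
Qed.

(** One term of the relative entropy is at least
    [3/2 (a - b)^2 / (a + 2 b)], and the free parameter [s] linearizes this
    quotient, so that summing over the coordinates and then optimizing [s]
    replaces the Cauchy-Schwarz inequality. *)
Lemma pinsker_term {R : realType} (a b s : R) : 0 < a -> 0 < b ->
  3 / 2 * (2 * s * `|a - b| - s ^+ 2 * (a + 2 * b)) <=
  a * (ln a - ln b) - a + b.
Proof.
move=> a0 b0; have ab : 0 < a + 2 * b by lra.
have := ln_ge_rational (divr_gt0 a0 b0); rewrite ln_div ?posrE // => H.
apply: (@le_trans _ _ (3 / 2 * ((a - b) ^+ 2 / (a + 2 * b)))).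
  rewrite ler_pM2l; last by lra.
  rewrite ler_pdivlMr // -[(a - b) ^+ 2]real_normK ?num_real //.
  have := sqr_ge0 (`|a - b| - s * (a + 2 * b)); set n := `|_|; nra.
rewrite -subr_ge0 in H; have := mulr_ge0 (ltW a0) H.
suff -> : a * (ln a - ln b -
    (5 / 2 - 1 / 4 * (a / b)^-1 - 27 / 4 * (a / b + 2)^-1)) =
  a * (ln a - ln b) - a + b - 3 / 2 * ((a - b) ^+ 2 / (a + 2 * b)) by rewrite subr_ge0.
by field; rewrite !lt0r_neq0 // addrC mulrC.
Qed.

(** This is the negative of Shannon's entropy, the sign that makes it convex. *)
Definition entropy {R : realType} {d : nat} (p : 'rV[R]_d) : R :=
  \sum_i p ord0 i * ln (p ord0 i).

Lemma pinsker {R : realType} {d : nat} (p m : 'rV[R]_d) :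
  (forall i, 0 < p ord0 i) -> (forall i, 0 < m ord0 i) ->
  \sum_i p ord0 i = 1 -> \sum_i m ord0 i = 1 ->
  norm1 (p - m) ^+ 2 / 2 <=
    \sum_i p ord0 i * (ln (p ord0 i) - ln (m ord0 i)).
Proof.
move=> p0 m0 p1 m1; set N := norm1 _.
(* The sum of [p + 2 m] is 3, so [2 s N - 3 s^2] is largest at [s = N / 3]. *)
pose s := N / 3.
have : \sum_i 3 / 2 * (2 * s * `|p ord0 i - m ord0 i| -
           s ^+ 2 * (p ord0 i + 2 * m ord0 i)) <=
       \sum_i (p ord0 i * (ln (p ord0 i) - ln (m ord0 i)) - p ord0 i + m ord0 i).
  by apply: ler_sum => i _; exact: pinsker_term.
rewrite -mulr_sumr sumrB -!mulr_sumr !big_split /= -mulr_sumr sumrN p1 m1.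
rewrite (_ : \sum_i `|p ord0 i - m ord0 i| = N); last first.
  by apply: eq_bigr => i _; rewrite !mxE.
rewrite /s; nra.
Qed.

(** With [m] the intermediate point, the convexity gap is the mean
    [t KL(p, m) + (1 - t) KL(q, m)] of relative entropies, to which Pinsker's
    inequality applies since [p - m] and [q - m] are multiples of [p - q]. *)
Lemma entropy_strongly_convex {R : realType} {d : nat} (t : R) (p q : 'rV[R]_d) :
  (forall i, 0 < p ord0 i) -> (forall i, 0 < q ord0 i) ->
  \sum_i p ord0 i = 1 -> \sum_i q ord0 i = 1 -> 0 <= t <= 1 ->
  entropy (t *: p + (1 - t) *: q) <= t * entropy p + (1 - t) * entropy q
     - t * (1 - t) / 2 * norm1 (p - q) ^+ 2.
Proof.
move=> p0 q0 p1 q1 /andP[t0 t1]; set m := _ + _.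
have mE i : m ord0 i = t * p ord0 i + (1 - t) * q ord0 i by rewrite !mxE.
have m0 i : 0 < m ord0 i by rewrite mE; have := p0 i; have := q0 i; nra.
have m1 : \sum_i m ord0 i = 1.
  under eq_bigr do rewrite mE.
  by rewrite big_split /= -!mulr_sumr p1 q1; ring.
have hp := pinsker p0 m0 p1 m1; have hq := pinsker q0 m0 q1 m1.
have E : entropy m = t * entropy p + (1 - t) * entropy q
   - t * (\sum_i p ord0 i * (ln (p ord0 i) - ln (m ord0 i)))
   - (1 - t) * (\sum_i q ord0 i * (ln (q ord0 i) - ln (m ord0 i))).
  rewrite /entropy !mulr_sumr -big_split -!sumrB; apply: eq_bigr => i _ /=.
  by rewrite {1}mE; ring.
have np : norm1 (p - m) = (1 - t) * norm1 (p - q).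
  have -> : p - m = (1 - t) *: (p - q) by apply/rowP => i; rewrite !mxE; ring.
  by rewrite norm1Z ger0_norm // subr_ge0.
have nq : norm1 (q - m) = t * norm1 (p - q).
  have -> : q - m = (- t) *: (p - q) by apply/rowP => i; rewrite !mxE; ring.
  by rewrite norm1Z normrN ger0_norm.
rewrite np exprMn in hp; rewrite nq exprMn in hq.
have t1' : 0 <= 1 - t by rewrite subr_ge0.
have := ler_wpM2l t0 hp; have := ler_wpM2l t1' hq.
rewrite E; set N := norm1 _ ^+ 2; lra.
Qed.

(** * The strict improvement on the entropy *)

Definition mix {R : realType} {d : nat} (l : R) (p : 'rV[R]_d) : 'rV[R]_d :=
  (1 - l) *: p + l *: const_mx d%:R^-1.

Lemma mixE {R : realType} {d : nat} (l : R) (p : 'rV[R]_d) (i : 'I_d) :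
  mix l p ord0 i = (1 - l) * p ord0 i + l * d%:R^-1.
Proof. by rewrite !mxE. Qed.

Lemma sum_const_inv {R : realType} (d : nat) : (0 < d)%N ->
  \sum_(i < d) d%:R^-1 = 1 :> R.
Proof.
move=> d0; rewrite sumr_const card_ord -[_ *+ d]mulr_natr mulVf //.
by rewrite pnatr_eq0 -lt0n.
Qed.

Lemma mix_pos {R : realType} {d : nat} (l : R) (p : 'rV[R]_d) (i : 'I_d) :
  0 < l < 1 -> simplex p -> 0 < mix l p ord0 i.
Proof.
move=> /andP[l0 l1] [p0 _]; rewrite mixE ltr_wpDl// ?mulr_ge0 ?subr_ge0 ?(ltW l1)//.
by rewrite mulr_gt0// invr_gt0 ltr0n (leq_ltn_trans _ (ltn_ord i)).
Qed.

Lemma mix_sum {R : realType} {d : nat} (l : R) (p : 'rV[R]_d) : (0 < d)%N ->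
  simplex p -> \sum_i mix l p ord0 i = 1.
Proof.
move=> d0 [_ p1]; under eq_bigr do rewrite mixE.
by rewrite big_split /= -!mulr_sumr p1 sum_const_inv //; ring.
Qed.

Lemma entropy_ge {R : realType} {d : nat} (p : 'rV[R]_d) : (0 < d)%N ->
  (forall i, 0 < p ord0 i) -> \sum_i p ord0 i = 1 -> - ln d%:R <= entropy p.
Proof.
move=> d0 p0 p1; have dR : (0 : R) < d%:R by rewrite ltr0n.
pose u : 'rV[R]_d := const_mx d%:R^-1.
have u0 i : 0 < u ord0 i by rewrite mxE invr_gt0.
have u1 : \sum_i u ord0 i = 1.
  by under eq_bigr do rewrite mxE; exact: sum_const_inv.
have := pinsker p0 u0 p1 u1.
rewrite (_ : \sum_i p ord0 i * _ = entropy p + ln d%:R); last first.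
  rewrite -[X in _ + X]mul1r -[X in _ + X * _]p1 mulr_suml -big_split.
  by apply: eq_bigr => i _ /=; rewrite mxE lnV ?posrE //; ring.
have := sqr_ge0 (norm1 (p - u)); lra.
Qed.

(** With [l = 1/d^3], the contracted vertex has [d - 1] coordinates
    [B = l/d = 1/d^4], so [ln B = - 4 ln d] and these coordinates contribute at
    most [- 2 l ln d] to the entropy.  The oscillation is then at most
    [(1 - 2 l) ln d / (1 - l)^2 < ln d]. *)
Lemma delta_star_lt {R : realType} {d : nat} : (1 < d)%N ->
  (delta_star R d < (1 / 2 * ln (d%:R : R))%:E)%E.
Proof.
move=> d1; have d0 : (0 < d)%N by lia.
have dR : (2 : R) <= d%:R by rewrite (ler_nat _ 2).
have dR0 : (0 : R) < d%:R by lra.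
pose l : R := d%:R^-1 ^+ 3.
have dV : 0 < (d%:R^-1 : R) <= 2^-1.
  by rewrite invr_gt0 dR0 lef_pV2 ?posrE.
have l01 : 0 < l < 1.
  by rewrite exprn_gt0 /= ?exprn_ilt1 //; have /andP[] := dV; lra.
have l1 : 0 < 1 - l by have /andP[] := l01; lra.
pose k : R := (1 - l) ^- 2.
have k0 : 0 < k by rewrite invr_gt0 exprn_gt0.
pose A : R := 1 - l + l * d%:R^-1; pose B : R := l * d%:R^-1.
pose hi : R := k * (A * ln A + (d%:R - 1) * (B * ln B)).
have H : (delta_star R d <= ((hi - k * - ln d%:R) / 2)%:E)%E.
  apply: (@delta_star_le _ _ (fun p => k * entropy (mix l p))) => //.
  - apply: continuous_in_subspaceT => p; rewrite inE => sp.
    apply: (@continuousM _ _ (cst k) (fun p : 'rV[R]_d => entropy (mix l p))).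
      exact: cst_continuous.
    apply: continuous_at_sum => i.
    have cm : {for p, continuous (fun q : 'rV[R]_d => mix l q ord0 i)}.
      rewrite (_ : (fun q => _) = (fun q : 'rV[R]_d => (1 - l) * q ord0 i + l * d%:R^-1)).
        apply: continuousD; last exact: cst_continuous.
        apply: (@continuousM _ _ (cst (1 - l)) (fun q : 'rV[R]_d => q ord0 i)).
          exact: cst_continuous.
        exact: coord_continuous.
      by apply/funext => q; rewrite mixE.
    apply: (@continuousM _ _ (fun q : 'rV[R]_d => mix l q ord0 i)
      (fun q : 'rV[R]_d => ln (mix l q ord0 i))) => //.
    apply: (@continuous_comp _ _ _ (fun q : 'rV[R]_d => mix l q ord0 i) (@ln R)) => //.
    by apply: continuous_ln; exact: mix_pos.
  - move=> t p q sp sq t01.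
    have -> : mix l (t *: p + (1 - t) *: q) = t *: mix l p + (1 - t) *: mix l q.
      by apply/rowP => i; rewrite !mxE; ring.
    have := @entropy_strongly_convex _ _ t (mix l p) (mix l q)
      (fun i => mix_pos i l01 sp) (fun i => mix_pos i l01 sq)
      (mix_sum l d0 sp) (mix_sum l d0 sq) t01.
    have -> : mix l p - mix l q = (1 - l) *: (p - q).
      by apply/rowP => i; rewrite !mxE; ring.
    rewrite norm1Z (gtr0_norm l1) exprMn -(ler_pM2l k0) => /le_trans; apply.
    rewrite -subr_ge0 le_eqVlt; apply/orP; left; rewrite eq_sym; apply/eqP.
    by rewrite /k; field; rewrite lt0r_neq0.
  - move=> q sq; rewrite ler_wpM2l ?(ltW k0)//; apply: entropy_ge => //.
      by move=> i; exact: mix_pos.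
    exact: mix_sum.
  - move=> i; rewrite /hi ler_wpM2l ?(ltW k0)// /entropy (bigD1 i) //=.
    rewrite mixE mxE !eqxx mulr1 -/A lerD2l.
    rewrite (eq_bigr (fun=> B * ln B)); last first.
      by move=> j ji; rewrite mixE mxE (negbTE ji) andbF mulr0 add0r -/B.
    rewrite sumr_const cardC1 card_ord -[_ *+ _]mulr_natl -subn1 natrB //.
apply: le_lt_trans H _; rewrite lte_fin.
have lnd : 0 < ln (d%:R : R) by apply: ln_gt0; lra.
have lnB : ln B = - 4 * ln d%:R.
  rewrite /B /l -exprSr lnXn ?invr_gt0 // lnV ?posrE // -[_ *+ 4]mulr_natr.
  by rewrite mulrC mulrN mulNr.
have B0 : 0 < B by rewrite mulr_gt0 ?invr_gt0 //; have /andP[] := l01.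
have Al : A < 1.
  have /andP[? ?] := dV; have /andP[? ?] := l01; rewrite /A; nra.
have AlnA : A * ln A <= 0.
  have A0 : 0 < A by rewrite /A addr_gt0 //.
  by rewrite pmulr_rle0 // ln_le0 // ltW.
have dB : (d%:R - 1) * B >= l / 2.
  rewrite /B mulrCA ler_wpM2l //; first by have /andP[/ltW] := l01.
  rewrite mulrBl mul1r mulfV ?lt0r_neq0 //; have /andP[_] := dV; lra.
have num : A * ln A + (d%:R - 1) * (B * ln B) + ln d%:R < (1 - l) ^+ 2 * ln d%:R.
  have : 0 < l ^+ 2 by rewrite exprn_gt0//; have /andP[] := l01.
  rewrite lnB; nra.
have : k * (A * ln A + (d%:R - 1) * (B * ln B) + ln d%:R) < ln d%:R.
  by rewrite [ltLHS]mulrC ltr_pdivrMr ?exprn_gt0 // [ltRHS]mulrC.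
rewrite /hi; lra.
Qed.

(** * The values of gamma *)

Lemma gamma2 {R : realType} : gamma R 2 = 1 / 4.
Proof.
have [[k [j [[k1 j0 jk jS] ->]]] _] := @gamma_is_max R 2 isT.
have := @admissible_homo 2 k j (And4 k1 j0 jk jS) 0%N k.
rewrite leqnn j0 jk => /(_ isT) hk; have kE : k = 1%N by lia.
by subst k; rewrite /gamma_sum big_nat1 /= j0 jk; field.
Qed.

Lemma gamma3 {R : realType} : gamma R 3 = 4 / 9.
Proof.
have [[k [j [[k1 j0 jk jS] E]]] ub] := @gamma_is_max R 3 isT.
have ge : 4 / 9 <= gamma R 3.
  apply: ub; exists 1%N, (fun n => if n is 0 then 1%N else 3%N); split.
    by split=> // -[].
  by rewrite /gamma_sum big_nat1 /=; field.
have := @admissible_homo 3 k j (And4 k1 j0 jk jS) 0%N k.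
rewrite leqnn j0 jk => /(_ isT) hk.
have [kE|kE] : k = 1%N \/ k = 2%N by lia.
  by rewrite E; subst k; rewrite /gamma_sum big_nat1 /= j0 jk; field.
subst k; move: ge; rewrite E /gamma_sum big_nat_recr //= big_nat1 /= j0 jk.
have -> : j 1%N = 2%N by have := jS 0%N isT; have := jS 1%N isT; lia.
lra.
Qed.

Unset Implicit Arguments.

Theorem theorem1p2 (R : realType) :
  (forall d : nat, (2 <= d)%N ->
     (delta_star R d < (1 / 2 * ln (d%:R : R))%:E)%E) /\
  (forall d : nat, d = 2%N \/ d = 3%N -> delta_star R d = (gamma R d)%:E).
Proof.
split=> [d d2|d [->|->]]; first exact: delta_star_lt.
- by rewrite delta_star2 gamma2.
- by rewrite delta_star3 gamma3.
Qed.
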